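(* Let $n\ge1$ and let $\alpha=(\alpha_1,\ldots,\alpha_p)$ and $\beta=(\beta_1,\ldots,\beta_q)$ be partitions of $n$ with $\gcd(\alpha_1,\ldots,\alpha_p,\beta_1,\ldots,\beta_q)=1$. Then there exists a weighted tree with passport $(\alpha,\beta)$ if and only if $p+q\le n+1$.
   Context: A weighted tree is a finite bicolored plane tree with positive integer edge weights. Bicolored means that every vertex is black or white and every edge joins vertices of different colors. Plane means that a cyclic order of edges at each vertex is fixed. The degree of a vertex is the sum of the weights of its incident edges. The total weight $n$ is the sum of all edge weights. The passport is the pair of partitions of $n$ formed by the degrees of the black vertices and the degrees of the white vertices. *)

(* Defs.v *)
From HB Require Import structures.
From mathcomp Require Import all_boot all_fingroup.

Set Implicit Arguments.
Unset Strict Implicit.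
Unset Printing Implicit Defensive.

Definition is_partition (n : nat) (s : seq nat) : bool :=
  [&& sorted geq s, all (ltn 0) s & sumn s == n].

Section Incidence.

Variables (B W E : finType) (bend : E -> B) (wend : E -> W).

Definition joined (b : B) (w : W) : bool :=
  [exists e, (bend e == b) && (wend e == w)].

Definition adjacent (u v : B + W) : bool :=
  match u, v with
  | inl b, inr w => joined b w
  | inr w, inl b => joined b w
  | _, _ => false
  end.

Definition connected_graph : Prop :=
  (exists v : B + W, true) /\ (forall u v : B + W, connect adjacent u v).

(* A cycle of length 2 is a pair of parallel edges, which [adjacent] does not *)
(* see: it is excluded by the first clause. In the second clause, a ucycle    *)
(* [:: u; v] only goes back and forth along one edge.                         *)
Definition acyclic_graph : Prop :=
  injective (fun e => (bend e, wend e)) /\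
  (forall c : seq (B + W), ucycle adjacent c -> size c <= 2).

Definition is_tree : Prop := connected_graph /\ acyclic_graph.

End Incidence.

(* [next] gives a cyclic order on each fibre of [endpoint]: it permutes the   *)
(* edges, and its cycles are exactly the sets of edges with a given endpoint. *)
Definition cyclic_order (E V : finType) (endpoint : E -> V)
    (next : {perm E}) : Prop :=
  forall e : E, porbit next e = [set f | endpoint f == endpoint e].

(* The plane structure is the pair of permutations [bnext], [wnext]; a tree   *)
(* with such cyclic orders always embeds in the plane.                        *)
Record weighted_tree : Type := WeightedTree {
  bvertex : finType;
  wvertex : finType;
  edge : finType;
  bend : edge -> bvertex;
  wend : edge -> wvertex;
  bnext : {perm edge};
  wnext : {perm edge};
  weight : edge -> nat;
  weighted_tree_is_tree : is_tree bend wend;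
  bnext_cyclic : cyclic_order bend bnext;
  wnext_cyclic : cyclic_order wend wnext;
  weight_gt0 : forall e, 0 < weight e
}.

Section Passport.

Variable T : weighted_tree.

Definition bdegree (b : bvertex T) : nat := \sum_(e | bend e == b) weight e.

Definition wdegree (w : wvertex T) : nat := \sum_(e | wend e == w) weight e.

Definition total_weight : nat := \sum_(e : edge T) weight e.

Definition passport : seq nat * seq nat :=
  (sort geq [seq bdegree b | b : bvertex T],
   sort geq [seq wdegree w | w : wvertex T]).

Lemma sumn_passport1 : sumn passport.1 = total_weight.
Proof.
rewrite (perm_sumn (permEl (perm_sort _ _))) sumnE big_image /=.
by rewrite /total_weight (partition_big (@bend T) xpredT).
Qed.

Lemma sumn_passport2 : sumn passport.2 = total_weight.
Proof.
rewrite (perm_sumn (permEl (perm_sort _ _))) sumnE big_image /=.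
by rewrite /total_weight (partition_big (@wend T) xpredT).
Qed.

End Passport.

(* Main.v *)
(* A weighted forest with prescribed degrees always exists (greedily). If two *)
(* of its components contain edges of different weights, these edges can be   *)
(* rerouted into a path joining the two components, with the same degrees at  *)
(* all vertices. When this is no longer possible and the forest is still      *)
(* disconnected, all weights are equal, so they divide the gcd of the degrees *)
(* and are 1; the forest then has n edges and at least two components, hence  *)
(* p + q >= n + 2 vertices. Conversely, a tree has p + q - 1 edges, of weight *)
(* at least 1.                                                                *)

Require Import Defs.
From mathcomp Require Import all_boot all_fingroup.
From mathcomp Require Import zify.

Set Implicit Arguments.
Unset Strict Implicit.
Unset Printing Implicit Defensive.

(** The forest of the argument above is a matrix of naturals indexed by black and white vertices,
    with the prescribed degrees as row and column sums; its nonzero entries are the edges. Being a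
    forest is the inequality edges + components <= vertices, so a move that gains at most one edge
    preserves it as soon as it merges two components. [exists_forest_matrix] builds such a matrix,
    [stitch] merges two components, and [exists_connected_matrix] iterates this, the gcd and the
    bound on p + q excluding a deadlock. [tree_of_matrix] makes a tree of the result, with arbitrary
    cyclic orders as plane structure. Necessity of the bound is [connected_card_le]. *)

Lemma exists_cyclic_order (E V : finType) (endpoint : E -> V) :
  exists next : {perm E}, cyclic_order endpoint next.
Proof.
pose fibre e := enum [set f | endpoint f == endpoint e].
have mem_fibre e f : (f \in fibre e) = (endpoint f == endpoint e).
  by rewrite mem_enum inE.
(* Edges with a common endpoint share one list, so the local successors glue into a permutation
   whose cycles are the fibres. *)
have fibreE e f : endpoint f = endpoint e -> fibre f = fibre e.
  by move=> ef; rewrite /fibre ef.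
pose succ e := path.next (fibre e) e.
have succ_end e : endpoint (succ e) = endpoint e.
  by apply/eqP; rewrite -mem_fibre mem_next mem_fibre.
have succ_inj : injective succ.
  apply: (can_inj (g := fun e => prev (fibre e) e)) => e.
  by rewrite (fibreE e) // prev_next // enum_uniq.
exists (perm succ_inj) => e; apply/setP => f; rewrite inE -mem_fibre.
have cyc : fcycle succ (fibre e).
  have := cycle_next (enum_uniq [set f | endpoint f == endpoint e]).
  apply: (@sub_in_cycle _ [pred f | endpoint f == endpoint e]).
    by move=> x y /eqP xe _ /eqP <-; rewrite /succ /= (fibreE e x xe).
  by apply/allP => g; rewrite mem_fibre.
have permE i : ((perm succ_inj) ^+ i)%g e = iter i succ e.
  by rewrite permX; apply: eq_iter => x; rewrite permE.
have e_fibre : e \in fibre e by rewrite mem_fibre.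
rewrite -(fconnect_cycle cyc e_fibre); apply/porbitP/idP => [[i ->]|].
  by rewrite permE fconnect_iter.
by move=> ef; exists (findex succ e f); rewrite permE iter_findex.
Qed.

(** * Edge counts in connected graphs *)

Section Graphs.

Variables (B W E : finType) (bend : E -> B) (wend : E -> W).

Lemma adjacentP (u v : B + W) :
  reflect (exists e, (u = inl (bend e) /\ v = inr (wend e)) \/
                     (v = inl (bend e) /\ u = inr (wend e)))
          (adjacent bend wend u v).
Proof.
apply: (iffP idP).
  by case: u v => [b|w] [b'|w'] //= /existsP[e /andP[/eqP <- /eqP <-]];
     exists e; [left | right].
by case=> e [] [-> ->] /=; apply/existsP; exists e; rewrite !eqxx.
Qed.

Lemma adjacent_sym : symmetric (adjacent bend wend).
Proof. by move=> [?|?] [?|?]. Qed.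

(** A vertex set grown one neighbour at a time gains at least one inner edge at each stage. *)
Lemma connected_card_le :
  connected_graph bend wend -> #|B| + #|W| <= #|E|.+1.
Proof.
case=> [[v0 _] conn].
pose inner (S : {set B + W}) :=
  [set e | (inl (bend e) \in S) && (inr (wend e) \in S)].
have grow k : k < #|{: B + W}| ->
    exists S : {set B + W}, #|S| = k.+1 /\ k <= #|inner S|.
  elim: k => [|k IHk] ltk; first by exists [set v0]; rewrite cards1.
  have [S [cardS leS]] := IHk (ltnW ltk).
  have [/existsP[u /existsP[v /and3P[uv uS vS]]] | noedge] :=
      boolP [exists u, exists v,
               [&& adjacent bend wend u v, u \in S & v \notin S]].
    exists (v |: S); split; first by rewrite cardsU1 vS cardS.
    have [e ends] := adjacentP _ _ uv.
    have eS : e \notin inner S.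
      by rewrite inE; case: ends => -[<- <-]; rewrite (negPf vS) ?andbF.
    rewrite -addn1 addnC; apply: leq_trans (_ : #|e |: inner S| <= _).
      by rewrite cardsU1 eS leq_add2l.
    apply/subset_leq_card/subsetP => f /setU1P[->|]; rewrite !inE.
      by case: ends => -[<- <-]; rewrite uS eqxx !orbT.
    by case/andP=> -> ->; rewrite !orbT.
  (* If no edge leaves [S], connectedness makes [S] the whole vertex set, which is too large. *)
  have clS : closed (adjacent bend wend) S.
    apply: intro_closed => [|u v uv uS].
      exact/sym_connect_sym/adjacent_sym.
    apply: contraNT noedge => vS; apply/existsP; exists u.
    by apply/existsP; exists v; rewrite uv uS.
  have [u uS] : exists u, u \in S by apply/card_gt0P; rewrite cardS.
  suff : #|{: B + W}| <= #|S| by rewrite cardS leqNgt ltk.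
  apply/subset_leq_card/subsetP => v _.
  by rewrite -(closed_connect clS (conn u v)).
have V_gt0 : 0 < #|{: B + W}| by apply/card_gt0P; exists v0.
have [|S [_ leS]] := grow #|{: B + W}|.-1; first by rewrite prednK.
by rewrite -card_sum -(prednK V_gt0) ltnS (leq_trans leS) // max_card.
Qed.

End Graphs.

(* Deleting an edge of a cycle preserves connectedness, so a connected graph  *)
(* with a cycle has more edges than [connected_card_le] requires.             *)
Lemma connected_is_tree (B W E : finType) (bend : E -> B) (wend : E -> W) :
  injective (fun e => (bend e, wend e)) ->
  connected_graph bend wend -> #|E| < #|B| + #|W| -> is_tree bend wend.
Proof.
move=> ends_inj conn ltE; split=> //; split=> // c /andP[cyc uniqc].
rewrite leqNgt; apply/negP => size_c.
case: c cyc uniqc size_c => [|x [|y [|z s]]] // cyc uniqc _.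
move: cyc => /= /and3P[xy yz zs].
move: uniqc; rewrite !cons_uniq => /and3P[xN yN _].
have [e0 ends0] := adjacentP _ _ _ _ xy.
pose E' := {e : E | e != e0}.
pose bend' (e : E') := bend (val e); pose wend' (e : E') := wend (val e).
have keep u v : adjacent bend wend u v ->
    (u, v) != (x, y) -> (u, v) != (y, x) -> adjacent bend' wend' u v.
  move=> /adjacentP[e ends] nxy nyx.
  have e_e0 : e != e0.
    apply: contraNneq nxy => ee0; move: nyx; rewrite !xpair_eqE; subst e.
    by case: ends ends0 => -[-> ->] [] [-> ->]; rewrite !eqxx.
  by apply/adjacentP; exists (Sub e e_e0 : E'); rewrite /bend' /wend' SubK.
have sym' : connect_sym (adjacent bend' wend').
  exact/sym_connect_sym/adjacent_sym.
(* The rest of the cycle is a detour around [e0]: after the step from [y] to [z] it never meets [y]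
   again. *)
have yx' : connect (adjacent bend' wend') y x.
  have Nyx : y != x by apply: contraNneq xN => ->; rewrite mem_head.
  have Nxz : z != x by apply: contraNneq xN => ->; rewrite !inE eqxx orbT.
  apply: (connect_trans (y := z)).
    apply/connect1/keep; rewrite ?xpair_eqE ?(negPf Nyx) ?(negPf Nxz) ?andbF //.
  apply/connectP; exists (rcons s x); last by rewrite last_rcons.
  apply: (sub_in_path (P := predC1 y)) zs => [u v|].
    rewrite /= !inE => uy vy /keep; apply; rewrite xpair_eqE;
    by rewrite ?(negPf uy) ?(negPf vy) ?andbF.
  apply/allP => u; rewrite !inE mem_rcons !inE => /or3P[/eqP->|/eqP->|us].
  - by apply: contraNneq yN => ->; rewrite mem_head.
  - by rewrite /= eq_sym.
  by apply: contraNneq yN => <-; rewrite inE us orbT.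
have conn' : connected_graph bend' wend'.
  split=> [|u v]; first by exists x.
  apply: connect_sub (proj2 conn u v) => {}u {}v uv.
  have [[-> ->]|nxy] := eqVneq (u, v) (x, y); first by rewrite sym'.
  have [[-> ->]|nyx] := eqVneq (u, v) (y, x); first by [].
  exact/connect1/keep.
have := connected_card_le conn'.
rewrite card_sig; have := cardC1 e0.
have : 0 < #|E| by apply/card_gt0P; exists e0.
rewrite -(eq_card (_ : [pred e | e != e0] =i predC1 e0)) //; lia.
Qed.

(** Roots represent components. Coarsening maps the roots of [e] onto those of [e'], and the roots
    of [x] and [y] get the same image. *)
Lemma card_roots_lt (T : finType) (e e' : rel T) (x y : T) :
  connect_sym e -> connect_sym e' -> subrel e (connect e') ->
  connect e' x y -> ~~ connect e x y -> #|roots e'| < #|roots e|.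
Proof.
move=> sym sym' sub xy' xy; have subc := connect_sub sub.
have root_root' z : root e' (root e z) = root e' z.
  by apply/esym/(rootP sym')/subc/connect_root.
have image_roots : #|roots e'| <= #|[set root e' z | z in roots e]|.
  apply/subset_leq_card/subsetP => r /eqP rr.
  apply/imsetP; exists (root e r); first exact: roots_root.
  by rewrite root_root' rr.
apply: leq_ltn_trans image_roots _.
rewrite ltn_neqAle leq_imset_card andbT; apply/imset_injP => inj.
move: xy; rewrite -(root_connect sym); case/eqP.
apply: inj; rewrite ?roots_root //; try exact: (roots_root sym).
by rewrite !root_root'; apply/(rootP sym').
Qed.

(** * Weighted forests as matrices of naturals *)

Section Matrices.

Variables B W : finType.
Implicit Type M : B -> W -> nat.

Definition support_adj M (u v : B + W) : bool :=
  match u, v with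
  | inl b, inr w => 0 < M b w
  | inr w, inl b => 0 < M b w
  | _, _ => false
  end.

Definition support M := [set x : B * W | 0 < M x.1 x.2].

Definition components M := #|roots (support_adj M)|.

(* The last clause says that the support is a forest, since in any graph the  *)
(* numbers of edges and of components add up to at least that of vertices.    *)
Definition forest_matrix (a : B -> nat) (b : W -> nat) M : Prop :=
  [/\ forall x, \sum_w M x w = a x, forall w, \sum_x M x w = b w
    & #|support M| + components M <= #|B| + #|W|].

Lemma support_sym M : connect_sym (support_adj M).
Proof. by apply: sym_connect_sym => -[?|?] [?|?]. Qed.

Lemma support_sub M M' :
  (forall x w, 0 < M x w -> connect (support_adj M') (inl x) (inr w)) ->
  subrel (support_adj M) (connect (support_adj M')).
Proof.
by move=> sub [x|w] [x'|w'] //= /sub; rewrite // support_sym.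
Qed.

Definition single (x : B) (w : W) (m : nat) : B -> W -> nat :=
  fun y v => ((y == x) && (v == w)) * m.

Lemma single_row x w m y : \sum_v single x w m y v = (y == x) * m.
Proof.
rewrite (bigD1 w) //= big1 => [|v /negPf vw]; rewrite /single.
  by rewrite eqxx andbT addn0.
by rewrite vw andbF.
Qed.

Lemma single_col x w m v : \sum_y single x w m y v = (v == w) * m.
Proof.
rewrite (bigD1 x) //= big1 => [|y /negPf yx]; rewrite /single.
  by rewrite eqxx addn0.
by rewrite yx.
Qed.

(* Greedy choice: joining [x] to [w] with weight [minn (a x) (b w)] exhausts  *)
(* one of them, which is then isolated in the forest of the remaining sums.   *)
Lemma exists_forest_matrix (a : B -> nat) (b : W -> nat) :
  \sum_x a x = \sum_w b w -> exists M, forest_matrix a b M.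
Proof.
have [n] := ubnP (\sum_x a x).
elim: n a b => // n IHn a b; rewrite ltnS => le_n eq_ab.
have [/eqP|] := posnP (\sum_x a x).
  (* The zero matrix: no edges, and at most as many components as vertices. *)
  move=> a0; exists (fun _ _ => 0); split=> [x|w|].
  - rewrite big1 //; apply/esym/eqP.
    by move: a0; rewrite sum_nat_eq0 => /forallP/(_ x).
  - rewrite big1 //; apply/esym/eqP.
    by move: a0; rewrite eq_ab sum_nat_eq0 => /forallP/(_ w).
  have -> : support (fun _ _ => 0) = set0 by apply/setP => x; rewrite !inE.
  by rewrite cards0 -card_sum max_card.
move=> a_gt0.
have [x ax] : exists x, 0 < a x.
  by apply/existsP; move: a_gt0; rewrite lt0n sum_nat_eq0 negb_forall;
     under eq_existsb do rewrite /= -lt0n.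
have [w bw] : exists w, 0 < b w.
  by apply/existsP; move: a_gt0; rewrite eq_ab lt0n sum_nat_eq0 negb_forall;
     under eq_existsb do rewrite /= -lt0n.
pose m := minn (a x) (b w).
have m_gt0 : 0 < m by rewrite leq_min ax.
pose a' y := a y - (y == x) * m; pose b' v := b v - (v == w) * m.
have aE y : a y = a' y + (y == x) * m.
  rewrite subnK //; case: eqP => [->|] //; rewrite mul1n; exact: geq_minl.
have bE v : b v = b' v + (v == w) * m.
  rewrite subnK //; case: eqP => [->|] //; rewrite mul1n; exact: geq_minr.
have sumI (I : finType) (i : I) : \sum_j (j == i) * m = m.
  by rewrite (bigD1 i) //= eqxx big1 ?addn0 ?mul1n // => j /negPf ->.
have sum_a : \sum_y a y = \sum_y a' y + m.
  by rewrite (eq_bigr _ (fun y _ => aE y)) big_split /= sumI.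
have sum_b : \sum_v b v = \sum_v b' v + m.
  by rewrite (eq_bigr _ (fun v _ => bE v)) big_split /= sumI.
have [||M [rowM colM forM]] := IHn a' b'; first by lia.
  by lia.
pose M' y v := M y v + single x w m y v.
exists M'; split=> [y|v|].
- by rewrite big_split /= single_row rowM -aE.
- by rewrite big_split /= single_col colM -bE.
have supp : #|support M'| <= #|support M|.+1.
  apply: leq_trans (_ : #|(x, w) |: support M| <= _); last first.
    by rewrite cardsU1 -add1n leq_add2r leq_b1.
  apply/subset_leq_card/subsetP => -[y v].
  rewrite !inE /= xpair_eqE /M' /single.
  by case: (_ && _) => //; rewrite addn0.
(* At most one edge was added, so the forest inequality survives if two components merge. *)
suff: components M' < components M by lia.
apply: (@card_roots_lt _ _ _ (inl x) (inr w)); try exact: support_sym.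
- by apply: support_sub => y v Myv; apply: connect1; rewrite /= addn_gt0 Myv.
- by apply: connect1; rewrite /= /M' /single !eqxx mul1n addn_gt0 m_gt0 orbT.
have isolated : a' x = 0 \/ b' w = 0.
  by rewrite /a' /b' !eqxx !mul1n /m; lia.
case: isolated => [a0|b0].
  apply/connectP => -[[|[y|v] p] //= /andP[Mxv _] _].
  by have := rowM x; rewrite a0 (bigD1 v) //=; lia.
rewrite support_sym.
apply/connectP => -[[|[y|v] p] //= /andP[Myw _] _].
by have := colM w; rewrite b0 (bigD1 y) //=; lia.
Qed.

(* The two edges [x1 - w1] of weight s and [x2 - w2] of weight t > s become   *)
(* the path [x1 - w2 - x2 - w1] with weights s, t - s, s.                     *)
Lemma stitch (a : B -> nat) (b : W -> nat) M x1 w1 x2 w2 :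
  forest_matrix a b M -> 0 < M x1 w1 -> M x1 w1 < M x2 w2 ->
  ~~ connect (support_adj M) (inl x1) (inl x2) ->
  exists2 M', forest_matrix a b M' & components M' < components M.
Proof.
case=> rowM colM forM M1 M2 disc; set s := M x1 w1 in M1 M2.
have Nx : x1 != x2 by apply: contraNneq disc => ->.
have Nw : w1 != w2.
  apply: contraNneq disc => w12; apply: (connect_trans (y := inr w1)).
    exact: connect1.
  by apply: connect1; rewrite /= w12; apply: leq_ltn_trans M2.
have Nx' : x2 != x1 by rewrite eq_sym.
have Nw' : w2 != w1 by rewrite eq_sym.
pose M' y v := M y v + single x1 w2 s y v + single x2 w1 s y v
               - (single x1 w1 s y v + single x2 w2 s y v).
(* The subtraction in [M'] is never truncated, since both diminished entries are at least [s]. *)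
have M'E y v : M' y v + (single x1 w1 s y v + single x2 w2 s y v)
             = M y v + single x1 w2 s y v + single x2 w1 s y v.
  apply: subnK; rewrite /single.
  case: (eqVneq y x1) => [->|_]; rewrite ?(negPf Nx) /=.
    by case: (eqVneq v w1) => [->|] //=; rewrite -/s; lia.
  case: (eqVneq y x2) => [->|_] //=.
  by case: (eqVneq v w2) => [->|] //=; lia.
(* Only the edge at [(x1, w1)] disappears: the strict inequality of weights keeps the one at
   [(x2, w2)]. *)
have M'gt0 y v : (y, v) != (x1, w1) -> 0 < M y v -> 0 < M' y v.
  rewrite xpair_eqE => /negPf N1 Myv.
  have N2 : (y == x2) && (v == w2) -> s < M y v by case/andP=> /eqP-> /eqP->.
  move: N2 (M'E y v); rewrite /single N1.
  case: ((y == x2) && (v == w2)) => [/(_ isT)|_]; last by lia.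
  by do 2!case: (_ && _); lia.
have M'12 : 0 < M' x1 w2.
  have := M'E x1 w2; rewrite /single !eqxx (negPf Nx) (negPf Nw') /=; lia.
have M'21 : 0 < M' x2 w1.
  by have := M'E x2 w1; rewrite /single !eqxx (negPf Nx') (negPf Nw) /=; lia.
have M'22 : 0 < M' x2 w2.
  apply: M'gt0; last by apply: leq_ltn_trans M2.
  by rewrite xpair_eqE (negPf Nx').
have x1x2 : connect (support_adj M') (inl x1) (inl x2).
  by apply: (connect_trans (y := inr w2)); apply: connect1.
have x1w1 : connect (support_adj M') (inl x1) (inr w1).
  by apply: connect_trans x1x2 (connect1 _).
have comp : components M' < components M.
  apply: (@card_roots_lt _ _ _ (inl x1) (inl x2)) => //; try exact: support_sym.
  apply: support_sub => y v Myv.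
  by have [[-> ->]|N1] := eqVneq (y, v) (x1, w1); last exact/connect1/M'gt0.
exists M' => //; split=> [y|v|].
- have : \sum_v (M' y v + (single x1 w1 s y v + single x2 w2 s y v))
       = \sum_v (M y v + single x1 w2 s y v + single x2 w1 s y v).
    by apply: eq_bigr => v _; apply: M'E.
  by rewrite !big_split /= !single_row rowM; lia.
- have : \sum_y (M' y v + (single x1 w1 s y v + single x2 w2 s y v))
       = \sum_y (M y v + single x1 w2 s y v + single x2 w1 s y v).
    by apply: eq_bigr => y _; apply: M'E.
  by rewrite !big_split /= !single_col colM; lia.
(* One edge is lost and at most two are gained, while the number of components drops. *)
suff: #|support M'| <= #|support M|.+1 by lia.
have M'11 : M' x1 w1 = 0.
  by rewrite /M' /single !eqxx (negPf Nx) (negPf Nw) /= -/s; lia.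
have supp1 : (x1, w1) \in support M by rewrite inE.
rewrite (cardsD1 (x1, w1) (support M)) supp1.
apply: leq_trans (_ : #|(x1, w2) |: ((x2, w1) |: support M :\ (x1, w1))| <= _).
  apply/subset_leq_card/subsetP => -[y v]; rewrite !inE /= => M'yv.
  case: (eqVneq (y, v) (x1, w2)) => //= N12.
  case: (eqVneq (y, v) (x2, w1)) => //= N21.
  have -> /= : (y, v) != (x1, w1).
    by apply/eqP => -[yx vw]; move: M'yv; rewrite yx vw M'11.
  have := M'E y v; rewrite /single -!xpair_eqE (negPf N12) (negPf N21); lia.
rewrite cardsU1 cardsU1; lia.
Qed.

Lemma exists_connected_matrix (a : B -> nat) (b : W -> nat) n :
  (forall x, 0 < a x) -> (forall w, 0 < b w) ->
  \sum_x a x = n -> \sum_w b w = n ->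
  (forall m, (forall x, m %| a x) -> (forall w, m %| b w) -> m = 1) ->
  #|B| + #|W| <= n.+1 ->
  exists2 M, forest_matrix a b M & components M <= 1.
Proof.
move=> a_gt0 b_gt0 sum_a sum_b gcd1 le_n.
have [M0 forM0] : exists M, forest_matrix a b M.
  by apply: exists_forest_matrix; rewrite sum_a.
have [k] := ubnP (components M0); elim: k => // k IHk in M0 forM0 *.
rewrite ltnS => le_k.
have [|disc] := leqP (components M0) 1; first by exists M0.
have [[x1 w1] | nostitch] := pickP [pred p1 : B * W | [exists p2 : B * W,
    [&& 0 < M0 p1.1 p1.2, M0 p1.1 p1.2 < M0 p2.1 p2.2
      & ~~ connect (support_adj M0) (inl p1.1) (inl p2.1)]]].
  case/existsP=> -[x2 w2] /and3P[/= M1 M2 N12].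
  have [M' forM' ltM'] := stitch forM0 M1 M2 N12.
  by apply: (IHk M' forM'); apply: leq_trans le_k.
exfalso; case: (forM0) => rowM colM forM.
have same x w x' w' : 0 < M0 x w -> 0 < M0 x' w' ->
    ~~ connect (support_adj M0) (inl x) (inl x') -> M0 x w = M0 x' w'.
  move=> Mxw Mxw' N.
  have [lt|lt|//] := ltngtP (M0 x w) (M0 x' w').
    have /negP[] := negbT (nostitch (x, w)).
    by apply/existsP; exists (x', w'); rewrite /= Mxw lt.
  have /negP[] := negbT (nostitch (x', w')).
  by apply/existsP; exists (x, w); rewrite /= Mxw' lt support_sym.
(* Degrees are positive, so every component contains an edge. *)
have edge_at (u : B + W) : exists x w, 0 < M0 x w /\
    connect (support_adj M0) u (inl x).
  case: u => [x|w].
    have : 0 < \sum_w M0 x w by rewrite rowM.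
    rewrite lt0n sum_nat_eq0 negb_forall => /existsP[w]; rewrite /= -lt0n.
    by exists x, w.
  have : 0 < \sum_x M0 x w by rewrite colM.
  rewrite lt0n sum_nat_eq0 negb_forall => /existsP[x]; rewrite /= -lt0n.
  by exists x, w; split=> //; apply: connect1.
have [u [v [ru rv uv]]] : exists u v, [/\ u \in roots (support_adj M0),
     v \in roots (support_adj M0) & u != v].
  exact/card_gt1P.
have Nuv : ~~ connect (support_adj M0) u v.
  by rewrite -(root_connect (@support_sym M0)) (eqP ru) (eqP rv).
have [xu [wu [Mu cu]]] := edge_at u; have [xv [wv [Mv cv]]] := edge_at v.
have csym := @support_sym M0.
have N0 : ~~ connect (support_adj M0) (inl xu) (inl xv).
  apply: contraNN Nuv => c0; apply: connect_trans cu _.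
  by apply: connect_trans c0 _; rewrite csym.
(* An edge in the component of [xu] is compared with the edge at [xv], any other directly with the
   edge at [xu]. *)
have weightE x w : 0 < M0 x w -> M0 x w = M0 xu wu.
  move=> Mxw.
  have [cx|] := boolP (connect (support_adj M0) (inl x) (inl xu)); last first.
    exact: same.
  rewrite (same _ _ _ _ Mu Mv N0); apply: same => //.
  by rewrite (same_connect csym cx).
have w_dvd x w : M0 xu wu %| M0 x w.
  by have [->|/weightE ->] := posnP (M0 x w).
have w1 : M0 xu wu = 1.
  by apply: gcd1 => z; rewrite -?rowM -?colM; apply: dvdn_sum.
(* With unit weights there are n edges; two components then contradict the bound on the number of
   vertices. *)
have : #|support M0| = n.
  rewrite -sum_a (eq_bigr _ (fun x _ => esym (rowM x))) pair_big /=.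
  rewrite -sum1_card big_mkcond /=; apply: eq_bigr => -[x w] _ /=.
  by rewrite inE /=; have [->|Mxw] := posnP; rewrite // weightE.
lia.
Qed.

(** * Plane trees from connected matrices *)

Lemma tree_of_matrix (a : B -> nat) (b : W -> nat) M :
  0 < #|B| + #|W| -> forest_matrix a b M -> components M <= 1 ->
  exists T : weighted_tree, passport T =
    (sort geq [seq a x | x : B], sort geq [seq b w | w : W]).
Proof.
move=> V_gt0 [rowM colM forM] conn.
pose E := {p in support M}.
pose bend (e : E) := (val e).1; pose wend (e : E) := (val e).2.
have adjE : adjacent bend wend =2 support_adj M.
  have joinE x w : joined bend wend x w = (0 < M x w).
    apply/existsP/idP => [[e /andP[/eqP <- /eqP <-]]|Mxw].
      by have := valP e; rewrite inE.
    have xw : (x, w) \in support M by rewrite inE.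
    by exists (exist _ (x, w) xw); rewrite /bend /wend /= !eqxx.
  by move=> [x|w] [x'|w'] //=.
have conn_g : connected_graph bend wend.
  split; first by move: V_gt0; rewrite -card_sum => /card_gt0P[v _]; exists v.
  move=> u v; rewrite (eq_connect adjE) -(root_connect (@support_sym M)).
  by apply/eqP/(card_le1_eqP conn); apply: roots_root (@support_sym M) _.
(* One component at least makes the forest inequality the strict edge bound of
   [connected_is_tree]. *)
have comp_gt0 : 0 < components M.
  move: V_gt0; rewrite -card_sum => /card_gt0P[v _].
  apply/card_gt0P; exists (root (support_adj M) v).
  exact: roots_root (@support_sym M) _.
have tree : is_tree bend wend.
  apply: connected_is_tree conn_g _.
    move=> e f ends_ef; apply: val_inj.
    by rewrite [LHS]surjective_pairing [RHS]surjective_pairing.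
  by apply: leq_trans forM; rewrite card_sig -addn1 leq_add2l.
have [bn bnP] := exists_cyclic_order bend.
have [wn wnP] := exists_cyclic_order wend.
have wt_gt0 (e : E) : 0 < M (val e).1 (val e).2 by have := valP e; rewrite inE.
pose T := WeightedTree tree bnP wnP wt_gt0.
have sumE (P : pred (B * W)) :
    \sum_(e : E | P (val e)) M (val e).1 (val e).2 = \sum_(p | P p) M p.1 p.2.
  rewrite -(big_sub_cond (support M) P (fun p => M p.1 p.2)).
  rewrite [RHS](bigID [in support M]) /= [X in _ + X]big1 ?addn0.
    by apply: eq_bigl => p; rewrite andbC.
  by move=> p /andP[_]; rewrite inE -eqn0Ngt => /eqP.
exists T; rewrite /passport; congr (sort _ _, sort _ _).
  apply: eq_map => x; rewrite /bdegree /= (sumE (fun p => p.1 == x)) -rowM.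
  rewrite -(big_pred1_eq addn x (fun y => \sum_w M y w)).
  by rewrite pair_big; apply: eq_bigl => p; rewrite andbT.
apply: eq_map => w; rewrite /wdegree /= (sumE (fun p => p.2 == w)) -colM.
have -> : \sum_x M x w = \sum_x \sum_(v | v == w) M x v.
  by apply: eq_bigr => x _; rewrite big_pred1_eq.
by rewrite pair_big_dep.
Qed.

End Matrices.

(** * The equivalence for partitions *)

Lemma nth_ord_image (s : seq nat) : [seq nth 0 s i | i : 'I_(size s)] = s.
Proof.
rewrite /image_mem (map_comp (nth 0 s) val) val_enum_ord.
by rewrite map_nth_iota0 // take_size.
Qed.

Theorem theorem3p3 (n : nat) (alpha beta : seq nat)
  (n_ge1 : 1 <= n)
  (alpha_part : is_partition n alpha)
  (beta_part : is_partition n beta)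
  (gcd_eq1 : \big[gcdn/0]_(k <- alpha ++ beta) k = 1) :
  (exists T : weighted_tree, passport T = (alpha, beta)) <->
  size alpha + size beta <= n + 1.
Proof.
case/and3P: alpha_part => sort_a pos_a /eqP sum_a.
case/and3P: beta_part => sort_b pos_b /eqP sum_b.
split=> [[T passT]|le_n].
  have <- : total_weight T = n by rewrite -sumn_passport1 passT.
  have -> : size alpha = #|bvertex T|.
    by rewrite -[alpha]/((alpha, beta).1) -passT size_sort size_image.
  have -> : size beta = #|wvertex T|.
    by rewrite -[beta]/((alpha, beta).2) -passT size_sort size_image.
  have [conn _] := weighted_tree_is_tree T.
  apply: leq_trans (connected_card_le conn) _.
  rewrite addn1 ltnS -sum1_card; apply: leq_sum => e _; exact: weight_gt0.
(* The positions in each partition serve as vertices. *)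
pose a (i : 'I_(size alpha)) := nth 0 alpha i.
pose b (i : 'I_(size beta)) := nth 0 beta i.
have sumE (s : seq nat) : \sum_(i < size s) nth 0 s i = sumn s.
  by rewrite -[in RHS](nth_ord_image s) sumnE big_image.
have [||||||M forM connM] := @exists_connected_matrix _ _ a b n.
- by move=> i; apply: (allP pos_a); apply: mem_nth.
- by move=> i; apply: (allP pos_b); apply: mem_nth.
- by rewrite sumE.
- by rewrite sumE.
- move=> m m_a m_b; apply/eqP; rewrite -dvdn1 -gcd_eq1 big_seq.
  elim/big_ind: _ => [//|k l mk ml|k]; first by rewrite dvdn_gcd mk.
  rewrite mem_cat => /orP[] /(nthP 0)[i lt_i <-].
    exact: (m_a (Ordinal lt_i)).
  exact: (m_b (Ordinal lt_i)).
- by rewrite !card_ord -addn1.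
have [|T passT] := tree_of_matrix _ forM connM.
  (* An empty [alpha] would have sum 0, against n >= 1. *)
  rewrite !card_ord; case: (alpha) sum_a => [|? ?] //=.
  by move=> n0; rewrite -n0 in n_ge1.
have geq_trans : transitive geq by move=> x y z yx xz; apply: leq_trans xz yx.
by exists T; rewrite passT !nth_ord_image !sorted_sort.
Qed.
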